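(* For all $n\ge1$, $$a_{\{0101,0102,0112,0120\}}(n)=a_{\{0101,0102,0112,0121\}}(n)=a_{\{0101,0112,0120,0121\}}(n)=1+\binom{n+1}{3}.$$
   Context: An ascent in an integer sequence $s_1\cdots s_m$ is an index $j$ with $s_j<s_{j+1}$; $\mathrm{asc}$ denotes the number of ascents. An ascent sequence is a sequence $x_1\cdots x_n$ of nonnegative integers with $x_1=0$ and $x_i\le 1+\mathrm{asc}(x_1\cdots x_{i-1})$ for all $i\ge2$. The reduction $\mathrm{red}(w)$ of an integer sequence $w$ replaces the $i$-th smallest distinct letter of $w$ by $i-1$; a pattern is a reduced sequence. A sequence $x$ contains a pattern $p=p_1\cdots p_k$ if there are indices $i_1<\cdots<i_k$ with $\mathrm{red}(x_{i_1}\cdots x_{i_k})=p$; otherwise $x$ avoids $p$. For a finite set $P$ of patterns, $a_P(n)$ denotes the number of ascent sequences of length $n$ avoiding every pattern in $P$. *)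

(* Defs.v *)
From mathcomp Require Import all_boot.
Set Implicit Arguments. Unset Strict Implicit. Unset Printing Implicit Defensive.

Fixpoint asc (s : seq nat) : nat :=
  match s with
  | a :: ((b :: _) as t) => (a < b) + asc t
  | _ => 0
  end.

Definition is_ascent_seq (x : seq nat) : bool :=
  (head 1 x == 0) &&
  [forall i : 'I_(size x), (0 < i) ==> (nth 0 x i <= (asc (take i x)).+1)].

(* reduction: the i-th smallest distinct letter becomes i-1, i.e. a letter a
   is replaced by the number of distinct letters of w smaller than a *)
Definition red (w : seq nat) : seq nat :=
  [seq size (undup [seq b <- w | b < a]) | a <- w].

(* a choice of indices i_1 < ... < i_k is a bit mask over the positions of x *)
Definition contains (x p : seq nat) : bool :=
  [exists m : (size x).-tuple bool, red (mask m x) == p].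

Definition avoids (x p : seq nat) : bool := ~~ contains x p.

(* every ascent sequence of length n has entries <= n-1, so all of them are
   n-tuples over 'I_n; a_P(n) counts those avoiding every pattern of P *)
Definition a_P (P : seq (seq nat)) (n : nat) : nat :=
  #|[set t : n.-tuple 'I_n |
      is_ascent_seq (map val t) &
      all (avoids (map val t)) P ]|.

Example red_ex : red [:: 5; 2; 5; 9] = [:: 1; 0; 1; 2]. Proof. by []. Qed.
Example asc_ex : asc [:: 0; 1; 0; 1; 1] = 2. Proof. by []. Qed.

(* Main.v *)
Require Import Defs.
From mathcomp Require Import all_boot zify.

Set Implicit Arguments. Unset Strict Implicit. Unset Printing Implicit Defensive.

(* In each of the three classes the avoiders other than 0^n are explicit words
   determined by a triple 0 < p <= q < r <= n: respectively
     0^a 1 2 ... (k-1) k^b (k-1)^c,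
     0^a 1 2 ... (k-1) k^b 0^c,
     0^a 1^b 0^c  or  0^a 1 0^c 2 3 ... (k-1) k^b  (k >= 2).
   Both the ascent condition and avoidance pass to prefixes, so the form is
   established one letter at a time: appending to a word of the given form a
   letter that leaves the form either exceeds the ascent bound or creates a
   forbidden pattern. The triples (p - 1, q, r) are the 3-subsets of {0, ..., n},
   whence 'C(n + 1, 3). *)

(** * Ascents and the ascent condition along a function on [nat] *)

Lemma take_mkseq (T : Type) (f : nat -> T) i n :
  i <= n -> take i (mkseq f n) = mkseq f i.
Proof. by move=> le_in; rewrite /mkseq -map_take take_iota (minn_idPl le_in). Qed.

Lemma asc_rcons2 s x y : asc (rcons (rcons s x) y) = asc (rcons s x) + (x < y).
Proof.
elim: s => [|a [|b s] IHs] /=; [lia | lia |].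
by move: IHs => /= ->; rewrite addnA.
Qed.

Lemma asc_mkseqSS X n :
  asc (mkseq X n.+2) = asc (mkseq X n.+1) + (X n < X n.+1).
Proof. by rewrite !mkseqS asc_rcons2. Qed.

(** Serves to verify closed forms [g] for ascent counts. The recurrence starts at length 2, where
    the first comparison occurs, hence two initial values. *)
Lemma asc_mkseq X g : g 0 = 0 -> g 1 = 0 ->
    (forall n, g n.+2 = g n.+1 + (X n < X n.+1)) ->
  forall n, asc (mkseq X n) = g n.
Proof.
move=> g0 g1 gS; case=> [|n]; first by rewrite g0.
by elim: n => [|n IHn]; [rewrite g1 | rewrite asc_mkseqSS gS IHn].
Qed.

(** A word is kept as a function with a separate length, so that passing to a prefix changes only
    the bound. *)
Definition ascending (X : nat -> nat) n :=
  X 0 = 0 /\ forall i, 0 < i < n -> X i <= (asc (mkseq X i)).+1.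

(** The default [1] of [head] makes [is_ascent_seq] reject the empty word, whence [0 < n]. *)
Lemma is_ascent_seq_mkseq X n : 0 < n ->
  is_ascent_seq (mkseq X n) <-> ascending X n.
Proof.
case: n => // n _; rewrite /is_ascent_seq; split.
- case/andP=> /eqP X0 /forallP ascX; split=> // i /andP[i_gt0 lt_in].
  have lt_is : i < size (mkseq X n.+1) by rewrite size_mkseq.
  move/implyP: (ascX (Ordinal lt_is)) => /= /(_ i_gt0).
  by rewrite nth_mkseq // take_mkseq // ltnW.
- case=> X0 ascX; apply/andP; split; first exact/eqP.
  apply/forallP=> i; apply/implyP=> i_gt0.
  have lt_in : i < n.+1 by move: (ltn_ord i); rewrite {2}size_mkseq.
  by rewrite nth_mkseq // take_mkseq ?(ltnW lt_in) // ascX ?i_gt0.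
Qed.

(** * Reduction, and containment of patterns of length four *)

(** The distinct letters below [b] include those below [a] and also [a] itself, which occurs in
    [w]. *)
Lemma red_mono w a b : a \in w -> a < b ->
  size (undup [seq c <- w | c < a]) < size (undup [seq c <- w | c < b]).
Proof.
move=> w_a lt_ab; set s := undup _; set t := undup _.
suff: size (a :: s) <= size t by [].
apply: uniq_leq_size => [|c].
  by rewrite /= undup_uniq mem_undup mem_filter ltnn.
rewrite inE !mem_undup !mem_filter => /orP[/eqP-> | /andP[lt_ca ->]].
  by rewrite lt_ab.
by rewrite (ltn_trans lt_ca lt_ab).
Qed.

Lemma ltn_red w i j : i < size w -> j < size w ->
  (nth 0 (red w) i < nth 0 (red w) j) = (nth 0 w i < nth 0 w j).
Proof.
move=> lt_i lt_j; rewrite !(nth_map 0) //.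
case: (ltngtP (nth 0 w i) (nth 0 w j)) => [lt | lt | ->]; last by rewrite ltnn.
- by rewrite red_mono // mem_nth.
- by apply/negbTE; rewrite -leqNgt ltnW // red_mono // mem_nth.
Qed.

(** Applying the mask to the index list [iota 0 n] instead of the values turns it into an increasing
    list of positions. *)
Lemma contains4P X n p : size p = 4 ->
  contains (mkseq X n) p <->
  exists i j k l, [/\ i < j, j < k, k < l, l < n & red [:: X i; X j; X k; X l] = p].
Proof.
move=> size_p; split.
- case/existsP=> m /eqP red_m.
  have: sorted ltn (mask m (iota 0 n)).
    by apply: (subseq_sorted ltn_trans (mask_subseq _ _)); apply: iota_ltn_sorted.
  have: {subset mask m (iota 0 n) <= iota 0 n} by move=> c; apply: mem_mask.
  move: red_m; rewrite /mkseq -map_mask.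
  case: (mask m (iota 0 n)) => [|i [|j [|k [|l [|? s]]]]] red_m sub_m //=;
    try by move: size_p; rewrite -red_m /red size_map.
  case/and4P=> lt_ij lt_jk lt_kl _; exists i, j, k, l; split=> //.
  by have:= sub_m l; rewrite !inE eqxx !orbT mem_iota => /(_ isT) /andP[].
- case=> i [j [k [l [lt_ij lt_jk lt_kl lt_ln red_ijkl]]]].
  have sub : subseq [:: i; j; k; l] (iota 0 n).
    (* Strictly increasing lists with the same members are equal, so the four indices form a filter
       of [iota 0 n]; being a subsequence, they come from a mask. *)
    have <- : [seq c <- iota 0 n | c \in [:: i; j; k; l]] = [:: i; j; k; l].
      apply: (irr_sorted_eq ltn_trans ltnn).
      - by apply: sorted_filter; [apply: ltn_trans | apply: iota_ltn_sorted].
      - by rewrite /= lt_ij lt_jk lt_kl.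
      - move=> c; rewrite mem_filter mem_iota !inE; apply/andb_idr.
        by move=> c_ijkl; lia.
    exact: filter_subseq.
  have /subseqP[m size_m def_m] := map_subseq X sub.
  have size_m' : size m == size (mkseq X n) by rewrite size_m.
  by apply/existsP; exists (Tuple size_m'); rewrite /= -def_m red_ijkl.
Qed.

Definition free4 (R : nat -> nat -> nat -> nat -> Prop) (X : nat -> nat) n :=
  forall i j k l, i < j -> j < k -> k < l -> l < n -> ~ R (X i) (X j) (X k) (X l).

Lemma avoids4 X n p (R : nat -> nat -> nat -> nat -> Prop) : size p = 4 ->
    (forall a b c d, red [:: a; b; c; d] = p <-> R a b c d) ->
  avoids (mkseq X n) p <-> free4 R X n.
Proof.
move=> size_p redP; split.
- move/negP=> avX i j k l lt_ij lt_jk lt_kl lt_ln /redP red_p.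
  by apply: avX; apply/contains4P => //; exists i, j, k, l.
- move=> freeX; apply/negP => /contains4P-/(_ size_p)[i [j [k [l [? ? ? ? /redP]]]]].
  exact: freeX.
Qed.

(** In each of these relations the three conditions fix, by transitivity, the relative order of all
    four letters. *)
Definition is0101 a b c d := [/\ a < b, c = a & d = b].
Definition is0102 a b c d := [/\ a < b, c = a & b < d].
Definition is0112 a b c d := [/\ a < b, c = b & b < d].
Definition is0120 a b c d := [/\ a < b, b < c & d = a].
Definition is0121 a b c d := [/\ a < b, b < c & d = b].

(** [ltn_red] for all twelve ordered pairs; a tie in the pattern shows up as two false strict
    comparisons. *)
Lemma red4_cmp a b c d p0 p1 p2 p3 : red [:: a; b; c; d] = [:: p0; p1; p2; p3] ->
  [/\ (a < b) = (p0 < p1), (b < a) = (p1 < p0), (a < c) = (p0 < p2) &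
      (c < a) = (p2 < p0)] /\
  [/\ (a < d) = (p0 < p3), (d < a) = (p3 < p0), (b < c) = (p1 < p2) &
      (c < b) = (p2 < p1)] /\
  [/\ (b < d) = (p1 < p3), (d < b) = (p3 < p1), (c < d) = (p2 < p3) &
      (d < c) = (p3 < p2)].
Proof.
move=> red_p; have:= fun i j => @ltn_red [:: a; b; c; d] i j.
rewrite red_p => cmp; split; [|split]; split; symmetry.
- exact: (cmp 0 1). - exact: (cmp 1 0). - exact: (cmp 0 2). - exact: (cmp 2 0).
- exact: (cmp 0 3). - exact: (cmp 3 0). - exact: (cmp 1 2). - exact: (cmp 2 1).
- exact: (cmp 1 3). - exact: (cmp 3 1). - exact: (cmp 2 3). - exact: (cmp 3 2).
Qed.

Ltac red4 :=
  move=> ? ? ? ?; split=> [/red4_cmp /= [[? ? ? ?] [[? ? ? ?] [? ? ? ?]]]|[? ? ?]]; [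
    by split; lia
  | subst; rewrite /red /=;
    repeat match goal with |- context [?x < ?y] =>
      first [have ->: (x < y) = true by lia | have ->: (x < y) = false by lia] end;
    rewrite /= !inE;
    repeat match goal with |- context [?x == ?y] =>
      first [have ->: (x == y) = true by lia | have ->: (x == y) = false by lia] end;
    by [] ].

Lemma avoids0101 X n : avoids (mkseq X n) [:: 0; 1; 0; 1] <-> free4 is0101 X n.
Proof. by apply: avoids4 => //; red4. Qed.

Lemma avoids0102 X n : avoids (mkseq X n) [:: 0; 1; 0; 2] <-> free4 is0102 X n.
Proof. by apply: avoids4 => //; red4. Qed.

Lemma avoids0112 X n : avoids (mkseq X n) [:: 0; 1; 1; 2] <-> free4 is0112 X n.
Proof. by apply: avoids4 => //; red4. Qed.

Lemma avoids0120 X n : avoids (mkseq X n) [:: 0; 1; 2; 0] <-> free4 is0120 X n.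
Proof. by apply: avoids4 => //; red4. Qed.

Lemma avoids0121 X n : avoids (mkseq X n) [:: 0; 1; 2; 1] <-> free4 is0121 X n.
Proof. by apply: avoids4 => //; red4. Qed.

(** * The three families of words and their parameters *)

Lemma eq_mkseq_lt (T : Type) (f g : nat -> T) n :
  (forall i, i < n -> f i = g i) -> mkseq f n = mkseq g n.
Proof. by move=> fg; apply/eq_in_map => i; rewrite mem_iota => /fg. Qed.

(* The exceptional triple (n, n, n + 1) stands for the all-zero word. *)
Definition admissible n p q r :=
  [/\ 0 < p, p <= q, q < r & r <= n \/ p = n /\ q = n /\ r = n.+1].

Definition has_shape (f : nat -> nat -> nat -> nat -> nat) n (X : nat -> nat) :=
  exists p q r, admissible n p q r /\ forall i, i < n -> X i = f p q r i.

(* With k = q - p + 1: 0^p 1 2 ... (k-1) k^(r-q) (k-1)^*. *)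
Definition word1 p q r i :=
  if i < p then 0 else if i < q then (i - p).+1 else
  if i < r then (q - p).+1 else q - p.

(* With k = q - p + 1: 0^p 1 2 ... (k-1) k^(r-q) 0^*. *)
Definition word2 p q r i :=
  if i < p then 0 else if i < q then (i - p).+1 else
  if i < r then (q - p).+1 else 0.

(* 0^p 1^(r-p) 0^* if p = q, and otherwise, with k = r - q + 1,
   0^p 1 0^(q-p-1) 2 3 ... (k-1) k^*. *)
Definition word3 p q r i :=
  if i < p then 0 else
  if p == q then i < r : nat else
  if i == p then 1 else if i < q then 0 else
  if i < r then (i - q).+2 else (r - q).+1.

(** The nested conditionals as a disjunction of linear facts, the form in which [lia] can use
    them. *)
Lemma word1P p q r i :
  i < p /\ word1 p q r i = 0 \/
  p <= i < q /\ word1 p q r i = (i - p).+1 \/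
  p <= i /\ q <= i < r /\ word1 p q r i = (q - p).+1 \/
  p <= i /\ q <= i /\ r <= i /\ word1 p q r i = q - p.
Proof. rewrite /word1; case: ltnP; case: ltnP; case: ltnP; lia. Qed.

Lemma word2P p q r i :
  i < p /\ word2 p q r i = 0 \/
  p <= i < q /\ word2 p q r i = (i - p).+1 \/
  p <= i /\ q <= i < r /\ word2 p q r i = (q - p).+1 \/
  p <= i /\ q <= i /\ r <= i /\ word2 p q r i = 0.
Proof. rewrite /word2; case: ltnP; case: ltnP; case: ltnP; lia. Qed.

Lemma word3P p q r i :
  i < p /\ word3 p q r i = 0 \/
  p = q /\ p <= i < r /\ word3 p q r i = 1 \/
  p = q /\ p <= i /\ r <= i /\ word3 p q r i = 0 \/
  p <> q /\ p = i /\ word3 p q r i = 1 \/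
  p <> q /\ p < i < q /\ word3 p q r i = 0 \/
  p <> q /\ p < i /\ q <= i < r /\ word3 p q r i = (i - q).+2 \/
  p <> q /\ p < i /\ q <= i /\ r <= i /\ word3 p q r i = (r - q).+1.
Proof.
rewrite /word3; case: ltnP => ?; first by lia.
case: (p =P q) => ?; first by case: ltnP => ? /=; lia.
by case: eqP => ?; case: ltnP => ?; case: ltnP => ?; lia.
Qed.

(** * Ascent counts of the words *)

(** The ascents are the steps into positions [p], ..., [q]; [minn] keeps those inside the prefix,
    and truncated subtraction gives 0 when [n <= p]. *)
Lemma asc_word1 p q r n : 0 < p <= q -> q < r ->
  asc (mkseq (word1 p q r) n) = minn n q.+1 - p.
Proof.
move=> ? ?; apply: (asc_mkseq (g := fun n => minn n q.+1 - p)); [lia | lia | move=> m].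
by have:= word1P p q r m; have:= word1P p q r m.+1; case: ltnP; lia.
Qed.

Lemma asc_word2 p q r n : 0 < p <= q -> q < r ->
  asc (mkseq (word2 p q r) n) = minn n q.+1 - p.
Proof.
move=> ? ?; apply: (asc_mkseq (g := fun n => minn n q.+1 - p)); [lia | lia | move=> m].
by have:= word2P p q r m; have:= word2P p q r m.+1; case: ltnP; lia.
Qed.

(** There is one ascent into position [p] and, if [p] differs from [q], one into each of [q], ...,
    [r - 1]; the letter at [r] repeats the one before it. *)
Lemma asc_word3 p q r n : 0 < p <= q -> q < r ->
  asc (mkseq (word3 p q r) n) =
    if p == q then p < n : nat else (p < n) + (minn n r - q).
Proof.
move=> ? ?.
apply: (asc_mkseq (g := fun n => if p == q then p < n : nat
                                 else (p < n) + (minn n r - q))); try by case: eqP; lia.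
move=> m; have:= word3P p q r m; have:= word3P p q r m.+1.
by case: eqP; case: (ltnP (word3 _ _ _ _)); lia.
Qed.

Lemma ascending_word1 p q r n : 0 < p <= q -> q < r -> ascending (word1 p q r) n.
Proof.
move=> ? ?; split=> [|i _]; first by have:= word1P p q r 0; lia.
by rewrite asc_word1 //; have:= word1P p q r i; lia.
Qed.

Lemma ascending_word2 p q r n : 0 < p <= q -> q < r -> ascending (word2 p q r) n.
Proof.
move=> ? ?; split=> [|i _]; first by have:= word2P p q r 0; lia.
by rewrite asc_word2 //; have:= word2P p q r i; lia.
Qed.

Lemma ascending_word3 p q r n : 0 < p <= q -> q < r -> ascending (word3 p q r) n.
Proof.
move=> ? ?; split=> [|i _]; first by have:= word3P p q r 0; lia.
by rewrite asc_word3 //; have:= word3P p q r i; case: eqP; lia.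
Qed.

(** * Avoidance of the patterns by the words *)

Ltac word_cases H := repeat (destruct H as [H|H]).

(** Each of the four positions is located in a segment of the word; contradictory choices are
    discarded after two and three positions to limit the case split. *)
Ltac word_free wordP :=
  intros ? ? i j k l ? ? ? _ [? ? ?];
  pose proof (wordP i) as Hi; pose proof (wordP j) as Hj;
  pose proof (wordP k) as Hk; pose proof (wordP l) as Hl;
  word_cases Hi; word_cases Hj; try (clear Hk Hl; lia);
  word_cases Hk; try (clear Hl; lia); word_cases Hl; lia.

Lemma word1_free0101 p q r n :
  0 < p <= q -> q < r -> free4 is0101 (word1 p q r) n.
Proof. word_free (word1P p q r). Qed.

Lemma word1_free0102 p q r n :
  0 < p <= q -> q < r -> free4 is0102 (word1 p q r) n.
Proof. word_free (word1P p q r). Qed.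

Lemma word1_free0112 p q r n :
  0 < p <= q -> q < r -> free4 is0112 (word1 p q r) n.
Proof. word_free (word1P p q r). Qed.

Lemma word1_free0120 p q r n :
  0 < p <= q -> q < r -> free4 is0120 (word1 p q r) n.
Proof. word_free (word1P p q r). Qed.

Lemma word2_free0101 p q r n :
  0 < p <= q -> q < r -> free4 is0101 (word2 p q r) n.
Proof. word_free (word2P p q r). Qed.

Lemma word2_free0102 p q r n :
  0 < p <= q -> q < r -> free4 is0102 (word2 p q r) n.
Proof. word_free (word2P p q r). Qed.

Lemma word2_free0112 p q r n :
  0 < p <= q -> q < r -> free4 is0112 (word2 p q r) n.
Proof. word_free (word2P p q r). Qed.

Lemma word2_free0121 p q r n :
  0 < p <= q -> q < r -> free4 is0121 (word2 p q r) n.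
Proof. word_free (word2P p q r). Qed.

Lemma word3_free0101 p q r n :
  0 < p <= q -> q < r -> free4 is0101 (word3 p q r) n.
Proof. word_free (word3P p q r). Qed.

Lemma word3_free0112 p q r n :
  0 < p <= q -> q < r -> free4 is0112 (word3 p q r) n.
Proof. word_free (word3P p q r). Qed.

Lemma word3_free0120 p q r n :
  0 < p <= q -> q < r -> free4 is0120 (word3 p q r) n.
Proof. word_free (word3P p q r). Qed.

Lemma word3_free0121 p q r n :
  0 < p <= q -> q < r -> free4 is0121 (word3 p q r) n.
Proof. word_free (word3P p q r). Qed.

(** * Classification of the avoiders, one letter at a time *)

(** Since the prefix of length [m] already agrees with a word of the family, the bound on the next
    letter is stated with the known ascent count of that word. *)
Lemma has_shape_ind (f : nat -> nat -> nat -> nat -> nat) (X : nat -> nat) n :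
    0 < n -> ascending X n -> (forall p q r i, i < p -> f p q r i = 0) ->
    (forall m p q r, 0 < m < n -> admissible m p q r ->
      (forall i, i < m -> X i = f p q r i) ->
      X m <= (asc (mkseq (f p q r) m)).+1 -> has_shape f m.+1 X) ->
  has_shape f n X.
Proof.
move=> n_gt0 [X0 ascX] f0 step.
suff main m : m < n -> has_shape f m.+1 X.
  by have:= main n.-1; rewrite prednK // leqnn => /(_ isT).
elim: m => [_ | m IHm lt_mn].
  (* The exceptional triple for length 1: the word [0]. *)
  by exists 1, 1, 2; split=> [|[|i]] //; [split=> //; right | rewrite X0 f0].
have [p [q [r [adm Xf]]]] := IHm (ltnW lt_mn).
by apply: (step _ p q r) => //; rewrite -(eq_mkseq_lt Xf) ascX.
Qed.

Lemma extend_shape f X m p q r p' q' r' :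
    (forall i, i < m -> X i = f p q r i) -> admissible m.+1 p' q' r' ->
    (forall i, i < m -> f p' q' r' i = f p q r i) -> X m = f p' q' r' m ->
  has_shape f m.+1 X.
Proof.
move=> Xf adm f'f Xm; exists p', q', r'; split=> // i.
by rewrite ltnS leq_eqVlt => /orP[/eqP->|lt_im] //; rewrite Xf ?f'f.
Qed.

Ltac extend_tac wordP Xf p q r p' q' r' :=
  apply: (extend_shape Xf (p' := p') (q' := q') (r' := r'));
  [ by split; lia
  | let i := fresh in move=> i ?; have:= wordP p q r i; have:= wordP p' q' r' i; lia
  | match goal with |- _ _ = _ _ _ _ ?m => have:= wordP p' q' r' m; lia end ].

(** The last position [l] is always that of the appended letter, so only the first three letters are
    replaced by those of the word. *)
Ltac pattern_tac wordP Xf p q r free i j k l :=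
  exfalso; apply: (free i j k l); [lia | lia | lia | lia |];
  rewrite (Xf i) ?(Xf j) ?(Xf k); [ | lia ..];
  have:= wordP p q r i; have:= wordP p q r j; have:= wordP p q r k;
  by split; lia.

Lemma shape_word1 X n : 0 < n -> ascending X n ->
    free4 is0101 X n -> free4 is0102 X n -> free4 is0112 X n -> free4 is0120 X n ->
  has_shape word1 n X.
Proof.
move=> n_gt0 ascX f0101 f0102 f0112 f0120; apply: has_shape_ind => //.
  by move=> p q r i lt_ip; rewrite /word1 lt_ip.
move=> m p q r /andP[m_gt0 lt_mn] [p_gt0 le_pq lt_qr rm] Xf.
rewrite asc_word1 ?p_gt0 // => Xm.
case: rm => [le_rm|[pm [qm rm]]]; last first.
  (* The prefix is all zeros and has no ascent, so the new letter is at most 1: [0] gives the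
     exceptional triple for [m.+1], and [1] gives [(m, m, m + 1)]. *)
  have [X0|X1] : X m = 0 \/ X m = 1 by lia.
    extend_tac word1P Xf p q r m.+1 m.+1 m.+2.
  extend_tac word1P Xf p q r m m m.+1.
have [lt_rm|eq_rm] : r < m \/ r = m by lia.
- have [Xsmall|[Xm0|Xbig]] : X m < q - p \/ X m = q - p \/ q - p < X m by lia.
  (* The letter [X m] already occurs at position [p + X m - 1], also when it is 0; the letters
     [q - p] and [q - p + 1] follow at [q - 1] and [q]. *)
  + pattern_tac word1P Xf p q r f0120 (p + X m).-1 q.-1 q m.
  + extend_tac word1P Xf p q r p q r.
  + have [Xk|Xk] : X m = (q - p).+1 \/ (q - p).+1 < X m by lia.
      pattern_tac word1P Xf p q r f0101 q.-1 q r m.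
    pattern_tac word1P Xf p q r f0102 q.-1 q r m.
- have [Xsmall|[Xm0|[Xk|Xbig]]] : X m < q - p \/ X m = q - p \/ X m = (q - p).+1
    \/ X m = (q - p).+2 by lia.
  + pattern_tac word1P Xf p q r f0120 (p + X m).-1 q.-1 q m.
  + extend_tac word1P Xf p q r p q m.
  + extend_tac word1P Xf p q r p q m.+1.
  (* A new maximum prolongs the staircase if the plateau has length one; a longer plateau supplies
     the repeated letter of [0112]. *)
  + have [q_last|q_short] : q.+1 = m \/ q.+1 < m by lia.
      extend_tac word1P Xf p q r p m m.+1.
    pattern_tac word1P Xf p q r f0112 0 q q.+1 m.
Qed.

Lemma shape_word2 X n : 0 < n -> ascending X n ->
    free4 is0101 X n -> free4 is0102 X n -> free4 is0112 X n -> free4 is0121 X n ->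
  has_shape word2 n X.
Proof.
move=> n_gt0 ascX f0101 f0102 f0112 f0121; apply: has_shape_ind => //.
  by move=> p q r i lt_ip; rewrite /word2 lt_ip.
move=> m p q r /andP[m_gt0 lt_mn] [p_gt0 le_pq lt_qr rm] Xf.
rewrite asc_word2 ?p_gt0 // => Xm.
case: rm => [le_rm|[pm [qm rm]]]; last first.
  have [X0|X1] : X m = 0 \/ X m = 1 by lia.
    extend_tac word2P Xf p q r m.+1 m.+1 m.+2.
  extend_tac word2P Xf p q r m m m.+1.
have [Xm0|[Xsmall|Xbig]] : X m = 0 \/ 0 < X m <= q - p \/ q - p < X m by lia.
- extend_tac word2P Xf p q r p q r.
(* The staircase carries [X m] at position [p + X m - 1], before the larger letter at [q]. *)
- pattern_tac word2P Xf p q r f0121 0 (p + X m).-1 q m.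
have [Xk|Xk] : X m = (q - p).+1 \/ X m = (q - p).+2 by lia.
- have [lt_rm|eq_rm] : r < m \/ r = m by lia.
    pattern_tac word2P Xf p q r f0101 0 q r m.
  extend_tac word2P Xf p q r p q m.+1.
- have [lt_rm|eq_rm] : r < m \/ r = m by lia.
    pattern_tac word2P Xf p q r f0102 0 q r m.
  have [q_last|q_short] : q.+1 = m \/ q.+1 < m by lia.
    extend_tac word2P Xf p q r p m m.+1.
  pattern_tac word2P Xf p q r f0112 0 q q.+1 m.
Qed.

Lemma shape_word3 X n : 0 < n -> ascending X n ->
    free4 is0101 X n -> free4 is0112 X n -> free4 is0120 X n -> free4 is0121 X n ->
  has_shape word3 n X.
Proof.
move=> n_gt0 ascX f0101 f0112 f0120 f0121; apply: has_shape_ind => //.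
  by move=> p q r i lt_ip; rewrite /word3 lt_ip.
move=> m p q r /andP[m_gt0 lt_mn] [p_gt0 le_pq lt_qr rm] Xf.
rewrite asc_word3 ?p_gt0 //.
case: rm => [le_rm|[pm [qm rm]]]; last first.
  rewrite pm qm eqxx ltnn => Xm.
  have [X0|X1] : X m = 0 \/ X m = 1 by lia.
    extend_tac word3P Xf p q r m.+1 m.+1 m.+2.
  extend_tac word3P Xf p q r m m m.+1.
case: eqP => [eq_pq|ne_pq] Xm.
  have [X0|[X1|X2]] : X m = 0 \/ X m = 1 \/ X m = 2 by lia.
  - extend_tac word3P Xf p q r p q r.
  - have [lt_rm|eq_rm] : r < m \/ r = m by lia.
      pattern_tac word3P Xf p q r f0101 0 p r m.
    extend_tac word3P Xf p q r p q m.+1.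
  (* With a single [1] so far, the letter 2 starts the second form of [word3], with [q = m]; with
     two of them it completes [0112]. *)
  - have [r_next|r_far] : r = p.+1 \/ p.+1 < r by lia.
      extend_tac word3P Xf p q r p m m.+1.
    pattern_tac word3P Xf p q r f0112 0 p p.+1 m.
have [X0|[X1|[Xmid|[Xk|Xbig]]]] : X m = 0 \/ X m = 1 \/ 1 < X m <= r - q \/
  X m = (r - q).+1 \/ X m = (r - q).+2 by lia.
- pattern_tac word3P Xf p q r f0120 0 p q m.
- pattern_tac word3P Xf p q r f0121 0 p r.-1 m.
(* The staircase [2, 3, ...] starts at [q], so [X m] occurs at [q + X m - 2]; the maximum is reached
   at [r - 1]. *)
- pattern_tac word3P Xf p q r f0121 0 (q + X m).-2 r.-1 m.
- extend_tac word3P Xf p q r p q r.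
- have [lt_rm|eq_rm] : r < m \/ r = m by lia.
    pattern_tac word3P Xf p q r f0112 0 r.-1 r m.
  extend_tac word3P Xf p q r p q m.+1.
Qed.

(** * Distinct triples give distinct words *)

Definition separates (f : nat -> nat -> nat -> nat -> nat) n :=
  forall p q r p' q' r', 0 < p <= q -> q < r <= n -> 0 < p' <= q' -> q' < r' <= n ->
  (forall i, i < n -> f p q r i = f p' q' r' i) -> [/\ p = p', q = q' & r = r'].

Ltac compare_at wordP eq_f p q r p' q' r' i :=
  pose proof (eq_f i); pose proof (wordP p q r i); pose proof (wordP p' q' r' i).

(** The parameters are recovered in the order [p], [q], [r]. Differing values of [p] or [r] show at
    the smaller one; for [q] both positions are inspected, since [word1] and [word2] may first
    differ after the smaller. *)
Ltac separate wordP :=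
  intros p q r p' q' r' ? ? ? ? eq_f;
  assert (p = p') by (case: (ltngtP p p') => // ?;
    [compare_at wordP eq_f p q r p' q' r' p | compare_at wordP eq_f p q r p' q' r' p'];
    lia);
  subst p';
  assert (q = q') by (case: (ltngtP q q') => // ?;
    compare_at wordP eq_f p q r p q' r' q; compare_at wordP eq_f p q r p q' r' q'; lia);
  subst q'; split=> //; case: (ltngtP r r') => // ?;
    [compare_at wordP eq_f p q r p q r' r | compare_at wordP eq_f p q r p q r' r'];
    lia.

Lemma word1_separates n : separates word1 n.
Proof. separate word1P. Qed.

Lemma word2_separates n : separates word2 n.
Proof. separate word2P. Qed.

Lemma word3_separates n : separates word3 n.
Proof. separate word3P. Qed.

(** * Counting by increasing triples *)

(** [inord] sends values out of range to 0, so the letters are recovered only under the bound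
    [X i < n.+1]. *)
Definition ord_word n (X : nat -> nat) : n.+1.-tuple 'I_n.+1 :=
  [tuple inord (X i) | i < n.+1].

Lemma map_val_ord_word n X : (forall i, i < n.+1 -> X i < n.+1) ->
  map val (ord_word n X) = mkseq X n.+1.
Proof.
move=> ltX; apply: (@eq_from_nth _ 0) => [|i].
  by rewrite size_map size_tuple size_mkseq.
rewrite size_map size_tuple => lt_in.
rewrite (nth_map ord0) ?size_tuple // nth_mkseq //.
by rewrite -(tnth_nth _ _ (Ordinal lt_in)) tnth_mktuple /= inordK ?ltX.
Qed.

Lemma eq_ord_word n X (t : n.+1.-tuple 'I_n.+1) :
  (forall i, i < n.+1 -> nth 0 (map val t) i = X i) -> t = ord_word n X.
Proof.
move=> tX; have szt : size (map val t) = n.+1 by rewrite size_map size_tuple.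
apply/val_inj/(inj_map val_inj); rewrite map_val_ord_word.
  by have:= mkseq_nth 0 (map val t); rewrite szt -(eq_mkseq_lt tX).
move=> i lt_in; rewrite -tX // (nth_map ord0) ?size_tuple //; exact: ltn_ord.
Qed.

Lemma ord_word_inj n X Y : (forall i, i < n.+1 -> X i < n.+1) ->
    (forall i, i < n.+1 -> Y i < n.+1) -> ord_word n X = ord_word n Y ->
  forall i, i < n.+1 -> X i = Y i.
Proof.
move=> ltX ltY eqXY i lt_in.
have: mkseq X n.+1 = mkseq Y n.+1 by rewrite -!map_val_ord_word // eqXY.
by move/(congr1 (nth 0 ^~ i)); rewrite !nth_mkseq.
Qed.

(* An increasing triple u0 < u1 < u2 <= n encodes p = u0 + 1, q = u1, r = u2. *)
Definition triple_word (f : nat -> nat -> nat -> nat -> nat) n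
    (u : 3.-tuple 'I_n.+2) : nat -> nat :=
  f (nth ord0 u 0).+1 (nth ord0 u 1) (nth ord0 u 2).

(** The avoiders are the zero word together with an injective image of the increasing triples:
    [separates] gives injectivity, the nonzero letter at [p] keeps the zero word out of the image,
    and [f p q r i <= i] makes all letters fit. *)
Lemma count_shapes f P n : 0 < n ->
    (forall X, is_ascent_seq (mkseq X n) && all (avoids (mkseq X n)) P
               <-> has_shape f n X) ->
    separates f n -> (forall p q r i, i < p -> f p q r i = 0) ->
    (forall p q r, 0 < p <= q -> q < r -> f p q r p != 0) ->
    (forall p q r i, 0 < p <= q -> q < r -> f p q r i <= i) ->
  a_P P n = 1 + 'C(n.+1, 3).
Proof.
case: n => // n _ shapeP sep f0 f_n0 f_le.
(* The length is now [n.+1], so the triples are drawn from [0], ..., [n.+1]. *)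
pose T := [set u : 3.-tuple 'I_n.+2 | sorted ltn (map val u)].
have inT u : u \in T -> nth ord0 u 0 < nth ord0 u 1 /\
    nth ord0 u 1 < nth ord0 u 2 <= n.+1.
  rewrite inE; case: u => [[|a [|b [|c []]]]] //= _.
  by move=> /and3P[-> -> _]; rewrite -ltnS ltn_ord.
have lt_word u i : u \in T -> i < n.+1 -> triple_word f u i < n.+1.
  move=> /inT[lt01 /andP[lt12 _]] lt_in; apply: leq_ltn_trans lt_in.
  exact: f_le.
have shape0 i : i < n.+1 -> 0 = f n.+1 n.+1 n.+2 i by move=> lt_in; rewrite f0.
rewrite /a_P -(card_ltn_sorted_tuples 3) -/T.
set S := finset _.
have -> : S = ord_word n (fun=> 0) |: [set ord_word n (triple_word f u) | u in T].
  apply/setP=> t; rewrite in_setU1 inE.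
  have szt : size (map val t) = n.+1 by rewrite size_map size_tuple.
  have def_t : map val t = mkseq (nth 0 (map val t)) n.+1.
    by have:= mkseq_nth 0 (map val t); rewrite szt.
  apply/idP/idP.
  - rewrite def_t => /shapeP[p [q [r [[p_gt0 le_pq lt_qr rn] tf]]]].
    case: rn => [le_rn|[pn [qn rn]]]; apply/orP; [right | left].
      have [lt_p [lt_q lt_r]] : p.-1 < n.+2 /\ q < n.+2 /\ r < n.+2 by lia.
      apply/imsetP; exists [tuple Ordinal lt_p; Ordinal lt_q; Ordinal lt_r].
        by rewrite inE /=; lia.
      by apply: eq_ord_word => i lt_in; rewrite tf // /triple_word /= prednK.
    by apply/eqP/eq_ord_word => i lt_in; rewrite tf // pn qn rn -shape0.
  - case/orP=> [/eqP->|/imsetP[u Tu ->]].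
      rewrite map_val_ord_word //; apply/shapeP; exists n.+1, n.+1, n.+2.
      by split=> //; split=> //; right.
    rewrite map_val_ord_word => [|i]; last exact: lt_word.
    have [lt01 /andP[lt12 lt2n]] := inT _ Tu; apply/shapeP.
    exists (nth ord0 u 0).+1, (nth ord0 u 1), (nth ord0 u 2).
    by split=> //; split=> //; left.
rewrite cardsU1 card_in_imset.
  suff -> : ord_word n (fun=> 0) \notin [set ord_word n (triple_word f u) | u in T].
    by [].
  apply/imsetP=> -[u Tu]; have [lt01 /andP[lt12 lt2n]] := inT _ Tu.
  have lt_u i := @lt_word u i Tu.
  move/ord_word_inj => /(_ _ lt_u (nth ord0 u 0).+1) eq0.
  (* Position [u0 + 1] is the parameter [p]; it lies inside the word because
     [u0 < u1 < u2 <= n + 1]. *)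
  have: triple_word f u (nth ord0 u 0).+1 != 0 by apply: f_n0.
  by rewrite -eq0 // (leq_ltn_trans lt01) // (leq_trans lt12).
move=> u v Tu Tv; have lt_u i := @lt_word u i Tu; have lt_v i := @lt_word v i Tv.
move/(ord_word_inj lt_u lt_v) => eq_uv.
have [lt01 lt12] := inT _ Tu; have [lt01' lt12'] := inT _ Tv.
have [[e0] e1 e2] := sep (nth ord0 u 0).+1 _ _ (nth ord0 v 0).+1 _ _ lt01
  lt12 lt01' lt12' eq_uv.
apply/val_inj; apply: (@eq_from_nth _ ord0) => [|i]; rewrite !size_tuple //.
by case: i => [|[|[|]]] // _; apply/val_inj.
Qed.

Theorem theorem5p1 (n : nat) : 1 <= n ->
  a_P [:: [:: 0; 1; 0; 1]; [:: 0; 1; 0; 2]; [:: 0; 1; 1; 2]; [:: 0; 1; 2; 0]] n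
    = 1 + 'C(n.+1, 3) /\
  a_P [:: [:: 0; 1; 0; 1]; [:: 0; 1; 0; 2]; [:: 0; 1; 1; 2]; [:: 0; 1; 2; 1]] n
    = 1 + 'C(n.+1, 3) /\
  a_P [:: [:: 0; 1; 0; 1]; [:: 0; 1; 1; 2]; [:: 0; 1; 2; 0]; [:: 0; 1; 2; 1]] n
    = 1 + 'C(n.+1, 3).
Proof.
move=> n_gt0; split; [|split].
- apply: (count_shapes (f := word1)) => //; [|exact: word1_separates|..].
  + move=> X; split.
      case/andP=> /is_ascent_seq_mkseq-/(_ n_gt0) ascX /and5P[].
      move=> /avoids0101 ? /avoids0102 ? /avoids0112 ? /avoids0120 ? _.
      exact: shape_word1.
    (* Conversely [X] is replaced by its word; the exceptional triple is treated like the others, as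
       it too satisfies [0 < p <= q < r]. *)
    case=> p [q [r [[p_gt0 le_pq lt_qr _] /eq_mkseq_lt->]]].
    have p_gt0q : 0 < p <= q by rewrite p_gt0.
    apply/andP; split; first by apply/is_ascent_seq_mkseq/ascending_word1.
    apply/and5P; split=> //.
    * exact/avoids0101/word1_free0101.
    * exact/avoids0102/word1_free0102.
    * exact/avoids0112/word1_free0112.
    * exact/avoids0120/word1_free0120.
  + by move=> p q r i lt_ip; rewrite /word1 lt_ip.
  + by move=> p q r ? ?; have:= word1P p q r p; lia.
  + by move=> p q r i ? ?; have:= word1P p q r i; lia.
- apply: (count_shapes (f := word2)) => //; [|exact: word2_separates|..].
  + move=> X; split.
      case/andP=> /is_ascent_seq_mkseq-/(_ n_gt0) ascX /and5P[].
      move=> /avoids0101 ? /avoids0102 ? /avoids0112 ? /avoids0121 ? _.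
      exact: shape_word2.
    case=> p [q [r [[p_gt0 le_pq lt_qr _] /eq_mkseq_lt->]]].
    have p_gt0q : 0 < p <= q by rewrite p_gt0.
    apply/andP; split; first by apply/is_ascent_seq_mkseq/ascending_word2.
    apply/and5P; split=> //.
    * exact/avoids0101/word2_free0101.
    * exact/avoids0102/word2_free0102.
    * exact/avoids0112/word2_free0112.
    * exact/avoids0121/word2_free0121.
  + by move=> p q r i lt_ip; rewrite /word2 lt_ip.
  + by move=> p q r ? ?; have:= word2P p q r p; lia.
  + by move=> p q r i ? ?; have:= word2P p q r i; lia.
- apply: (count_shapes (f := word3)) => //; [|exact: word3_separates|..].
  + move=> X; split.
      case/andP=> /is_ascent_seq_mkseq-/(_ n_gt0) ascX /and5P[].
      move=> /avoids0101 ? /avoids0112 ? /avoids0120 ? /avoids0121 ? _.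
      exact: shape_word3.
    case=> p [q [r [[p_gt0 le_pq lt_qr _] /eq_mkseq_lt->]]].
    have p_gt0q : 0 < p <= q by rewrite p_gt0.
    apply/andP; split; first by apply/is_ascent_seq_mkseq/ascending_word3.
    apply/and5P; split=> //.
    * exact/avoids0101/word3_free0101.
    * exact/avoids0112/word3_free0112.
    * exact/avoids0120/word3_free0120.
    * exact/avoids0121/word3_free0121.
  + by move=> p q r i lt_ip; rewrite /word3 lt_ip.
  + by move=> p q r ? ?; have:= word3P p q r p; lia.
  + by move=> p q r i ? ?; have:= word3P p q r i; lia.
Qed.
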